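(* Let $\mu$ be a $\sigma$-finite positive measure on a set $X$, let $D$ be an invertible positive multiplication operator on the complex space $L^2(X,\mu)$, and let $A$ be a positive bounded linear operator on $L^2(X,\mu)$. Then $$w(A)^2 \le w(D A) \, w(D^{-1} A)$$ and $$w(A)^2 \le w(A D) \, w(A D^{-1}).$$
   Context: $L^2(X,\mu)$ is the complex Hilbert space with inner product $\langle f, g\rangle = \int_X f \overline{g}\, d\mu$ and norm $\|\cdot\|_2$. The numerical radius of a bounded linear operator $A$ on $L^2(X,\mu)$ is $w(A) = \sup\{ |\langle A f, f\rangle| : f \in L^2(X,\mu),\ \|f\|_2 = 1\}$. An operator on $L^2(X,\mu)$ is called positive if it maps nonnegative functions to nonnegative functions (this is positivity in the order sense, not positive semidefiniteness). A multiplication operator $D$ on $L^2(X,\mu)$ is an operator of the form $Df = d f$ for all $f \in L^2(X,\mu)$, where $d \in L^\infty(X,\mu)$ is a fixed function. Invertible means invertible as a bounded linear operator on $L^2(X,\mu)$. *)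

(* Defs.v *)
From HB Require Import structures.
From mathcomp Require Import all_boot all_order all_algebra.
From mathcomp Require Import generic_quotient ring_quotient.
From mathcomp Require Import all_classical all_reals all_analysis.
From mathcomp Require Import measurable_realfun complex.

Set Implicit Arguments.
Unset Strict Implicit.
Unset Printing Implicit Defensive.

Import Order.TTheory GRing.Theory Num.Theory.
Import numFieldNormedType.Exports.
Import ComplexField.Normc.

Local Open Scope classical_set_scope.
Local Open Scope ring_scope.
Local Open Scope complex_scope.

Section complex_L2.
Context d (T : measurableType d) (R : realType).
Variable mu : {measure set T -> \bar R}.

(* Not the Re, Im of Num.Theory, whose values lie in R[i]. *)
Local Notation Re := (@complex.Re R).
Local Notation Im := (@complex.Im R).
Local Notation normc := (@normc R).

(* R[i] carries no sigma-algebra in the library: Borel measurability of a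
   complex function is that of its real and imaginary parts. *)
Definition cmeasurable (f : T -> R[i]) : Prop :=
  measurable_fun setT (Re \o f) /\ measurable_fun setT (Im \o f).

(* The functions (not classes) of the complex space L^p. *)
Definition cLfun (p : \bar R) : {pred T -> R[i]} :=
  mem [set f | cmeasurable f /\ finite_norm mu p (normc \o f)].

Lemma cLfunP p f :
  f \in cLfun p <-> cmeasurable f /\ finite_norm mu p (normc \o f).
Proof. by split=> [/set_mem|/mem_set]. Qed.

Lemma normc_ge0 (z : R[i]) : 0 <= normc z.
Proof. by case: z => a b; exact: sqrtr_ge0. Qed.

Lemma normcD_le (z w : R[i]) : normc (z + w) <= normc z + normc w.
Proof. by rewrite -lecR rmorphD; exact: (ler_normD z w). Qed.

Lemma normc_sqr (z : R[i]) : normc z ^+ 2 = Re z ^+ 2 + Im z ^+ 2.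
Proof. by case: z => a b /=; rewrite sqr_sqrtr// addr_ge0 ?sqr_ge0. Qed.

Lemma measurable_normc f : cmeasurable f -> measurable_fun setT (normc \o f).
Proof.
case=> mr mi.
have -> : normc \o f =
    Num.sqrt \o (fun x => (Re \o f) x ^+ 2 + (Im \o f) x ^+ 2).
  by apply/funext => x /=; rewrite -normc_sqr sqrtr_sqr ger0_norm ?normc_ge0.
apply: measurableT_comp; last by apply: measurable_funD; exact: measurable_funX.
by apply: continuous_measurable_fun; exact: sqrt_continuous.
Qed.

Lemma cmeasurable_lin (a : R[i]) f g :
  cmeasurable f -> cmeasurable g -> cmeasurable (a *: f + g).
Proof.
move=> [fr fi] [gr gi]; split.
- have -> : Re \o (a *: f + g) =
     (fun x => (Re a * (Re \o f) x - Im a * (Im \o f) x)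
               + (Re \o g) x).
    by apply/funext => x /=; rewrite !fctE; case: a (f x) (g x) => ? ? [? ?] [].
  by apply: measurable_funD => //; apply: measurable_funB;
    apply: measurable_funM => //; exact: measurable_cst.
- have -> : Im \o (a *: f + g) =
     (fun x => (Re a * (Im \o f) x + Im a * (Re \o f) x)
               + (Im \o g) x).
    by apply/funext => x /=; rewrite !fctE; case: a (f x) (g x) => ? ? [? ?] [].
  by apply: measurable_funD => //; apply: measurable_funD;
    apply: measurable_funM => //; exact: measurable_cst.
Qed.

Let one_le2 : (1 <= 2%:E :> \bar R)%E.
Proof. by rewrite lee_fin ler1n. Qed.

Lemma finite_norm2E (f : T -> R) : finite_norm mu 2%:E f <->
  (\int[mu]_x (f x ^+ 2)%:E < +oo)%E.
Proof.
have E : (\int[mu]_x (f x ^+ 2)%:E = 'N[mu]_2%:E[EFin \o f] `^ 2)%E.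
  rewrite poweR_Lnorm ?pnatr_eq0//; apply: eq_integral => x _ /=.
  by rewrite powR_mulrn// -normrX ger0_norm// sqr_ge0.
by rewrite /finite_norm E; split => [/poweR_lty|/lty_poweRy]//; apply;
  rewrite ?pnatr_eq0.
Qed.

Lemma cLfun2_submod_closed : submod_closed (cLfun 2%:E).
Proof.
split.
  apply/cLfunP; split; first by split; exact: measurable_cst.
  rewrite /finite_norm (_ : EFin \o _ = cst 0%E); last first.
    by apply/funext => x /=; congr EFin; exact: normc0.
  by rewrite Lnorm0// eqe pnatr_eq0.
move=> a f g /cLfunP[mf nf] /cLfunP[mg ng]; apply/cLfunP.
have mh := cmeasurable_lin a mf mg; split => //.
have nf2 : (normc \o f : T -> R) \in Lfun mu 2%:E.
  by apply/andP; split; apply: mem_set => //; exact: measurable_normc.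
have ng2 : (normc \o g : T -> R) \in Lfun mu 2%:E.
  by apply/andP; split; apply: mem_set => //; exact: measurable_normc.
have := Lfun_submod_closed mu one_le2.
case=> _ /(_ (normc a) _ _ nf2 ng2) /andP[/set_mem mH /set_mem/= nH].
apply/finite_norm2E; move/finite_norm2E : nH; apply: le_lt_trans.
apply: ge0_le_integral => //.
- by move=> x _; rewrite lee_fin sqr_ge0.
- by apply/measurable_EFinP; apply: measurable_funX; exact: measurable_normc.
- by apply/measurable_EFinP; apply: measurable_funX.
- move=> x _; rewrite lee_fin ler_sqr ?nnegrE ?normc_ge0//.
    by rewrite (le_trans (normcD_le _ _))// !fctE normcM.
  by rewrite addr_ge0 ?normc_ge0//= mulr_ge0 ?normc_ge0.
Qed.

HB.instance Definition _ := GRing.isSubmodClosed.Build R[i] (T -> R[i])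
  (cLfun 2%:E) cLfun2_submod_closed.

Record cL2fun := CL2fun {
  cL2fun_val :> T -> R[i];
  cL2funP : cL2fun_val \in cLfun 2%:E }.

HB.instance Definition _ := [isSub for cL2fun_val].
HB.instance Definition _ := [Choice of cL2fun by <:].
HB.instance Definition _ := [SubChoice_isSubLmodule of cL2fun by <:].

Definition cL2null : {pred cL2fun} :=
  mem [set f | {ae mu, forall x, cL2fun_val f x = 0}].

Lemma cL2null_submod_closed : submod_closed cL2null.
Proof.
split; first by apply: mem_set; apply: nearW.
move=> a f g /set_mem f0 /set_mem g0; apply: mem_set => /=.
by apply: filterS2 f0 g0 => x; rewrite !fctE => -> ->; rewrite scaler0 addr0.
Qed.

HB.instance Definition _ := GRing.isSubmodClosed.Build R[i] cL2fun
  cL2null cL2null_submod_closed.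

(* The complex space L^2(X, mu): square-integrable functions modulo the
   almost everywhere null ones. *)
Definition cL2 : Type := Quotient.quot cL2null.
HB.instance Definition _ := GRing.Zmodule.on cL2.
HB.instance Definition _ := EqQuotient.on cL2.

Local Open Scope quotient_scope.

Definition cL2_to_fun (u : cL2) : T -> R[i] := cL2fun_val (repr u).
Coercion cL2_to_fun : cL2 >-> Funclass.

Lemma cL2_pi_eqP (f g : cL2fun) :
  \pi_cL2 f = \pi_cL2 g <-> {ae mu, forall x, f x = g x}.
Proof.
have -> : (\pi_cL2 f = \pi_cL2 g) <-> (f - g \in cL2null).
  by rewrite (Quotient.idealrBE cL2null f g); split => [/eqP|/eqP].
split => [/set_mem|h]; last apply: mem_set; last move: h.
  by apply: filterS => x /= /eqP; rewrite subr_eq0 => /eqP.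
by apply: filterS => x /= e; rewrite !fctE e subrr.
Qed.

Lemma cL2_eqP (u v : cL2) : u = v <-> {ae mu, forall x, u x = v x}.
Proof. by rewrite -{1}[u]reprK -{1}[v]reprK; exact: cL2_pi_eqP. Qed.

Lemma cL2_piE (f : cL2fun) : {ae mu, forall x, (\pi_cL2 f : cL2) x = f x}.
Proof. by apply/cL2_pi_eqP; rewrite reprK. Qed.

Definition cL2scale (a : R[i]) (u : cL2) : cL2 := \pi_cL2 (a *: repr u).

Lemma cL2scale_pi a f : cL2scale a (\pi_cL2 f) = \pi_cL2 (a *: f).
Proof.
apply/cL2_pi_eqP; have := cL2_piE f.
by apply: filterS => x; rewrite /cL2_to_fun /= !fctE => ->.
Qed.

Let cL2add_pi (f g : cL2fun) : \pi_cL2 f + \pi_cL2 g = \pi_cL2 (f + g) :> cL2.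
Proof. by rewrite [RHS]Quotient.pi_add. Qed.

Let cL2scaleA a b u : cL2scale a (cL2scale b u) = cL2scale (a * b) u.
Proof.
rewrite -[u]reprK (cL2scale_pi b) (cL2scale_pi a).
by rewrite (cL2scale_pi (a * b)) scalerA.
Qed.

Let cL2scale1 : left_id 1 cL2scale.
Proof. by move=> u; rewrite -[u]reprK (cL2scale_pi 1) scale1r. Qed.

Let cL2scaleDr : right_distributive cL2scale +%R.
Proof.
move=> a u v; rewrite -[u]reprK -[v]reprK cL2add_pi.
rewrite (cL2scale_pi a (repr u)) (cL2scale_pi a (repr v)).
by rewrite (cL2scale_pi a (_ + _)) scalerDr cL2add_pi.
Qed.

Let cL2scaleDl u : {morph cL2scale^~ u : a b / a + b}.
Proof.
move=> a b; rewrite -[u]reprK (cL2scale_pi a) (cL2scale_pi b).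
by rewrite (cL2scale_pi (a + b)) scalerDl cL2add_pi.
Qed.

HB.instance Definition _ := GRing.Zmodule_isLmodule.Build R[i] cL2
  cL2scaleA cL2scale1 cL2scaleDr cL2scaleDl.

Lemma cL2D (u v : cL2) : {ae mu, forall x, (u + v : cL2) x = u x + v x}.
Proof. by have := cL2_piE (repr u + repr v); rewrite -cL2add_pi !reprK. Qed.

Lemma cL2Z a (u : cL2) : {ae mu, forall x, (a *: u : cL2) x = a * u x}.
Proof. exact: cL2_piE. Qed.

(* The integral of a complex function is computed on its real and imaginary
   parts. *)
Definition cL2dot (u v : cL2) : R[i] :=
  Complex (\int[mu]_x Re (u x * conjc (v x)))
          (\int[mu]_x Im (u x * conjc (v x))).

Definition cL2norm (u : cL2) : R :=
  fine ('N[mu]_2%:E [EFin \o (normc \o u)])%E.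

Definition bounded_op (A : cL2 -> cL2) : Prop :=
  exists M : R, forall u, cL2norm (A u) <= M * cL2norm u.

(* The set is bounded above when A is bounded, so that its real supremum is
   meaningful. It is empty only if L^2 = 0, in which case sup is 0. *)
Definition numerical_radius (A : cL2 -> cL2) : R :=
  sup [set normc (cL2dot (A u) u) | u in [set u | cL2norm u = 1]].

(* In R[i], 0 <= z means that z is real and nonnegative. *)
Definition cL2_nonneg (u : cL2) : Prop := {ae mu, forall x, 0 <= u x}.

Definition positive_op (A : cL2 -> cL2) : Prop :=
  forall u, cL2_nonneg u -> cL2_nonneg (A u).

Definition multiplication_op (D : cL2 -> cL2) : Prop :=
  exists2 m : T -> R[i], m \in cLfun +oo%E &
    forall u, {ae mu, forall x, D u x = m x * u x}.

Definition inverse_op (D D' : cL2 -> cL2) : Prop :=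
  [/\ bounded_op D', cancel D D' & cancel D' D].

End complex_L2.

(* Main.v *)
Require Import Defs.
From HB Require Import structures.
From mathcomp Require Import all_boot all_order all_algebra.
From mathcomp Require Import generic_quotient.
From mathcomp Require Import all_classical all_reals all_analysis.
From mathcomp Require Import measurable_realfun ess_sup_inf complex lra ring.

(** The numerical radius of a positive operator A can be computed on nonnegative
    functions: |A f| <= A |f| almost everywhere, hence
    |<A f, f>| <= <A |f|, |f|>, while f and |f| have the same norm
    ([numerical_value_le]).

    On nonnegative functions the two inequalities come from the pointwise
    arithmetic-geometric mean inequality 2 <= t m + 1 / (t m), valid for every
    real t > 0, where m > 0 is the function by which D multiplies: the operator
    t D + t^-1 D^-1 - 2 is positive ([multiplication_op_AMGM]). Composing it
    with A on either side gives again a positive operator, so that for every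
    f >= 0 of norm 1
<<
      2 <A f, f> <= t <D A f, f> + t^-1 <D^-1 A f, f>
                 <= t w(D A) + t^-1 w(D^-1 A),
>>
    and likewise with A D and A D^-1. Optimizing over t
    yields <A f, f>^2 <= w(D A) w(D^-1 A) ([numerical_radius_AMGM]).

    The suprema are meaningful because all the operators are bounded: the
    bound |<u, v>| <= |u|^2 + |v|^2 ([normc_dot_le_sqr]) is enough. The
    almost everywhere inequality |A f| <= A |f| follows from
    Re (q A f) <= |q| A |f|, which for one q is positivity of A applied to
    |q f| - Re (q f), by letting q range over the countable dense set of
    complex numbers with rational parts. *)

Set Implicit Arguments.
Unset Strict Implicit.
Unset Printing Implicit Defensive.

Import Order.TTheory GRing.Theory Num.Theory.
Import ComplexField.Normc.

Local Open Scope classical_set_scope.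
Local Open Scope ring_scope.

Local Notation Re := complex.Re.
Local Notation Im := complex.Im.

(** * Preliminaries on integrals and complex numbers *)

(** The best t is sqrt (c / b), but t = a / b already gives the claim; for
    b = 0 letting t grow forces a = 0. *)
Lemma sqr_le_of_AMGM (R : realFieldType) (a b c : R) :
  0 <= a -> 0 <= b -> 0 <= c ->
  (forall t, 0 < t -> 2 * a <= t * b + t^-1 * c) -> a ^+ 2 <= b * c.
Proof.
rewrite le_eqVlt => /predU1P[<- b0 c0 _|a0 b0 c0 H].
  by rewrite expr0n mulr_ge0.
move: b0; rewrite le_eqVlt => /predU1P[b0|b0].
  have := H ((c + 1) / a) ltac:(apply: divr_gt0 => //; lra).
  rewrite -b0 mulr0 add0r invf_div => h.
  have : a / (c + 1) * c < a.
    by rewrite mulrAC ltr_pdivrMr ?ltr_pM2l//; lra.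
  lra.
have := H (a / b) (divr_gt0 a0 b0).
rewrite divfK ?gt_eqF// invf_div => h.
have : a <= b / a * c by lra.
by rewrite mulrAC ler_pdivlMr// expr2.
Qed.

Section ae_integral.
Context d (T : measurableType d) (R : realType).
Variable mu : {measure set T -> \bar R}.

Lemma ae_le_Rintegral (f g : T -> R) :
  mu.-integrable setT (EFin \o f) -> mu.-integrable setT (EFin \o g) ->
  {ae mu, forall x, f x <= g x} -> \int[mu]_x f x <= \int[mu]_x g x.
Proof.
move=> fi gi fg; rewrite -subr_ge0 -RintegralB//.
have bi : mu.-integrable setT (EFin \o (fun x => g x - f x)).
  by apply: eq_integrable (integrableB measurableT gi fi).
suff -> : \int[mu]_x (g x - f x) = \int[mu]_x `|g x - f x|.
  by apply: Rintegral_ge0.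
congr fine; apply: ae_eq_integral => //.
- exact: measurable_int bi.
- have := measurable_int _ (integrable_abse bi).
  by apply: eq_measurable_fun => x _ /=.
- by apply: filterS fg => x fgx _; rewrite ger0_norm// subr_ge0.
Qed.

Lemma ae_eq_Rintegral (f g : T -> R) :
  mu.-integrable setT (EFin \o f) -> mu.-integrable setT (EFin \o g) ->
  {ae mu, forall x, f x = g x} -> \int[mu]_x f x = \int[mu]_x g x.
Proof.
move=> fi gi fg; apply/eqP; rewrite eq_le; apply/andP; split;
  by apply: ae_le_Rintegral => //; apply: filterS fg => x ->.
Qed.

End ae_integral.

Section complex_pointwise.
Variable R : realType.
Implicit Types z w : R[i].

Lemma Re_mulc z w : Re (z * w) = Re z * Re w - Im z * Im w.
Proof. by case: z w => [? ?] []. Qed.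

Lemma Im_mulc z w : Im (z * w) = Re z * Im w + Im z * Re w.
Proof. by case: z w => [? ?] []. Qed.

Lemma Re_addc z w : Re (z + w) = Re z + Re w.
Proof. by case: z w => [? ?] []. Qed.

Lemma Im_addc z w : Im (z + w) = Im z + Im w.
Proof. by case: z w => [? ?] []. Qed.

Lemma normc_conjc z : normc (conjc z) = normc z.
Proof. by case: z => a b /=; rewrite sqrrN. Qed.

Lemma normcR (a : R) : normc a%:C%C = `|a|.
Proof. by rewrite /normc/= expr0n addr0 sqrtr_sqr. Qed.

Lemma Re_conjc z : Re (conjc z) = Re z. Proof. by case: z. Qed.
Lemma Im_conjc z : Im (conjc z) = - Im z. Proof. by case: z. Qed.

Lemma normr_Re_le z : `|Re z| <= normc z.
Proof.
rewrite -ler_sqr ?nnegrE ?normr_ge0 ?normc_ge0// normc_sqr real_normK ?num_real//.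
by rewrite lerDl sqr_ge0.
Qed.

Lemma normr_Im_le z : `|Im z| <= normc z.
Proof.
rewrite -ler_sqr ?nnegrE ?normr_ge0 ?normc_ge0// normc_sqr real_normK ?num_real//.
by rewrite lerDr sqr_ge0.
Qed.

Lemma complex_ge0 z : (0 <= z) = (Im z == 0) && (0 <= Re z).
Proof. by case: z. Qed.

Lemma normc_ge0E z : 0 <= z -> z = (normc z)%:C%C.
Proof.
rewrite complex_ge0; case: z => a b /= /andP[/eqP -> a0].
by rewrite expr0n addr0 sqrtr_sqr ger0_norm.
Qed.

(** A choice q = conjc z would give the claim at once. An approximation of it
    with rational parts does as well, and there are only countably many of
    these, which is what makes the lemma usable almost everywhere. *)
Lemma normc_le_rat z (w : R) :
  (forall p : rat * rat, let q := Complex (ratr p.1) (ratr p.2) in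
     Re (q * z) <= normc q * w) ->
  0 <= w -> normc z <= w.
Proof.
move=> H w0; have [->//|z0] := eqVneq (normc z) 0.
have zpos : 0 < normc z by rewrite lt0r z0 normc_ge0.
apply/ler_addgt0Pr => e e0.
(* The total error below is 2 eta (|z| + w), which is e |z| for this eta. *)
set eta := e * normc z / (2 * (normc z + w)).
have eta0 : 0 < eta by rewrite divr_gt0 ?mulr_gt0// ltr_wpDr.
have [a] := @rat_in_itvoo R (Re z - eta) (Re z + eta) ltac:(lra).
rewrite in_itv/= => /andP[a1 a2].
have [b] := @rat_in_itvoo R (- Im z - eta) (- Im z + eta) ltac:(lra).
rewrite in_itv/= => /andP[b1 b2].
pose q : R[i] := Complex (ratr a) (ratr b).
have Hq : Re (q * z) <= normc q * w := H (a, b).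
have dq : normc (q - conjc z) <= 2 * eta.
  have h := normcD_le (ratr a - Re z)%:C%C (Complex 0 (ratr b + Im z)).
  have -> : q - conjc z = (ratr a - Re z)%:C%C + Complex 0 (ratr b + Im z).
    by rewrite /q; case: (z) => x y; apply/eqP;
      rewrite eq_complex/= opprK addr0 add0r !eqxx.
  apply: le_trans h _; rewrite normcR /normc/= expr0n add0r sqrtr_sqr.
  have : `|ratr a - Re z| <= eta by rewrite ler_norml; lra.
  have : `|ratr b + Im z| <= eta by rewrite ler_norml; lra.
  lra.
have nq : normc q <= normc z + 2 * eta.
  have := normcD_le (conjc z) (q - conjc z).
  by rewrite addrC subrK normc_conjc; lra.
have rq : normc z ^+ 2 - 2 * eta * normc z <= Re (q * z).
  have -> : q * z = (q - conjc z) * z + conjc z * z by rewrite -mulrDl subrK.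
  rewrite Re_addc (Re_mulc (conjc z)) Re_conjc Im_conjc mulNr opprK.
  rewrite -!expr2 -normc_sqr; have := normr_Re_le ((q - conjc z) * z).
  rewrite normcM ler_norml => /andP[h _].
  have : normc (q - conjc z) * normc z <= 2 * eta * normc z.
    by rewrite ler_wpM2r// ltW.
  lra.
have key : normc z ^+ 2 <= normc z * w + 2 * eta * (normc z + w).
  have : normc q * w <= (normc z + 2 * eta) * w by rewrite ler_wpM2r.
  lra.
have E : 2 * eta * (normc z + w) = e * normc z.
  rewrite /eta; field; lra.
rewrite E in key; rewrite -(ler_pM2l zpos); lra.
Qed.

End complex_pointwise.

(** * The complex space of square integrable functions *)

Section L2_facts.
Context d (T : measurableType d) (R : realType).
Variable mu : {measure set T -> \bar R}.
Implicit Types u v w : cL2 mu.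

Lemma cL2_cmeasurable u : cmeasurable u.
Proof. by have /cLfunP[] := cL2funP (repr u). Qed.

Lemma cL2_measurable_normc u : measurable_fun setT (fun x => normc (u x)).
Proof. exact: measurable_normc (cL2_cmeasurable u). Qed.

Lemma integrable_normc_sqr u :
  mu.-integrable setT (EFin \o (fun x => normc (u x) ^+ 2)).
Proof.
apply/integrableP; split.
  by apply/measurable_EFinP/measurable_funX; exact: cL2_measurable_normc.
have /cLfunP[_ /finite_norm2E] := cL2funP (repr u).
by move=> h; under eq_integral => x _ do rewrite gee0_abs ?lee_fin ?sqr_ge0//.
Qed.

Lemma cL2norm_ge0 u : 0 <= cL2norm u.
Proof. by rewrite fine_ge0// Lnorm_ge0. Qed.

Lemma cL2norm_sqr u : cL2norm u ^+ 2 = \int[mu]_x (normc (u x) ^+ 2).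
Proof.
have /cLfunP[_ nu] := cL2funP (repr u).
have E : (\int[mu]_x (normc (u x) ^+ 2)%:E
    = 'N[mu]_2%:E[EFin \o (@normc R \o u)] `^ 2)%E.
  rewrite poweR_Lnorm ?pnatr_eq0//; apply: eq_integral => x _ /=.
  by rewrite powR_mulrn// -normrX ger0_norm// sqr_ge0.
rewrite /Rintegral E /cL2norm -[in RHS](@fineK _ ('N[mu]_2%:E[_])%E); last first.
  by rewrite ge0_fin_numE// Lnorm_ge0.
by rewrite poweR_EFin/= powR_mulrn// cL2norm_ge0.
Qed.

Lemma cL2norm_ler u v : {ae mu, forall x, normc (u x) <= normc (v x)} ->
  cL2norm u <= cL2norm v.
Proof.
move=> uv; rewrite -ler_sqr ?nnegrE ?cL2norm_ge0// !cL2norm_sqr.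
apply: ae_le_Rintegral; try exact: integrable_normc_sqr.
by apply: filterS uv => x; rewrite ler_sqr ?nnegrE ?normc_ge0.
Qed.

Lemma cL2_of_dominated u (h : T -> R[i]) : cmeasurable h ->
  (forall x, normc (h x) <= normc (u x)) ->
  exists v : cL2 mu, {ae mu, forall x, v x = h x}.
Proof.
move=> mh hu; have hL : h \in cLfun mu 2%:E.
  apply/cLfunP; split=> //; apply/finite_norm2E.
  have /cLfunP[_ /finite_norm2E] := cL2funP (repr u); apply: le_lt_trans.
  apply: ge0_le_integral => //.
  - by move=> x _; rewrite lee_fin sqr_ge0.
  - by apply/measurable_EFinP; apply: measurable_funX; exact: measurable_normc.
  - by apply/measurable_EFinP; apply: measurable_funX; exact: cL2_measurable_normc.
  - by move=> x _; rewrite lee_fin ler_sqr ?nnegrE ?normc_ge0//; exact: hu.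
by exists (\pi_(cL2 mu) (CL2fun hL))%qT; exact: cL2_piE.
Qed.

Lemma dot_measurable u v :
  measurable_fun setT (fun x => Re (u x * conjc (v x))) /\
  measurable_fun setT (fun x => Im (u x * conjc (v x))).
Proof.
have [[ur ui] [vr vi]] := (cL2_cmeasurable u, cL2_cmeasurable v); split.
- under eq_fun => x do rewrite Re_mulc Re_conjc Im_conjc mulrN opprK.
  by apply: measurable_funD; apply: measurable_funM.
- under eq_fun => x do rewrite Im_mulc Re_conjc Im_conjc mulrN addrC.
  by apply: measurable_funB; apply: measurable_funM.
Qed.

Lemma integrable_normc_mul u v :
  mu.-integrable setT (EFin \o (fun x => normc (u x) * normc (v x))).
Proof.
have h := integrableD measurableT
    (integrable_normc_sqr u) (integrable_normc_sqr v).
apply: le_integrable h => //.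
  by apply/measurable_EFinP; apply: measurable_funM; exact: cL2_measurable_normc.
move=> x _; rewrite /= lee_fin !ger0_norm ?addr_ge0 ?mulr_ge0 ?sqr_ge0 ?normc_ge0//.
have := sqr_ge0 (normc (u x) - normc (v x)).
have := sqr_ge0 (normc (u x) + normc (v x)).
rewrite sqrrB sqrrD; lra.
Qed.

Lemma dot_integrable u v :
  mu.-integrable setT (EFin \o (fun x => Re (u x * conjc (v x)))) /\
  mu.-integrable setT (EFin \o (fun x => Im (u x * conjc (v x)))).
Proof.
have [mr mi] := dot_measurable u v.
have h := integrable_normc_mul u v.
have nE x : `|normc (u x) * normc (v x)| = normc (u x * conjc (v x)).
  by rewrite ger0_norm ?mulr_ge0 ?normc_ge0// normcM normc_conjc.
split; (apply: le_integrable h => //; first exact/measurable_EFinP) => x _.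
- by rewrite !abse_EFin lee_fin nE normr_Re_le.
- by rewrite !abse_EFin lee_fin nE normr_Im_le.
Qed.

Lemma cL2dotDl u v w : cL2dot (u + v) w = cL2dot u w + cL2dot v w.
Proof.
have [[i1 j1] [i2 j2]] := (dot_integrable u w, dot_integrable v w).
have [i3 j3] := dot_integrable (u + v) w.
apply/eqP; rewrite eq_complex Re_addc Im_addc/= -!RintegralD//.
apply/andP; split; apply/eqP; apply: ae_eq_Rintegral => //.
- exact: (integrableD measurableT i1 i2).
- by apply: filterS (cL2D u v) => x ->; rewrite mulrDl Re_addc.
- exact: (integrableD measurableT j1 j2).
- by apply: filterS (cL2D u v) => x ->; rewrite mulrDl Im_addc.
Qed.

Lemma cL2dotZl (a : R[i]) u w : cL2dot (a *: u) w = a * cL2dot u w.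
Proof.
have [i1 j1] := dot_integrable u w.
have [i3 j3] := dot_integrable (a *: u) w.
apply/eqP; rewrite eq_complex Re_mulc Im_mulc/= -!RintegralZl//.
rewrite -RintegralD// -?RintegralB//.
apply/andP; split; apply/eqP; apply: ae_eq_Rintegral => //.
- by apply: eq_integrable (integrableB measurableT
    (integrableZl measurableT (Re a) i1) (integrableZl measurableT (Im a) j1)).
- by apply: filterS (cL2Z a u) => x ->; rewrite -mulrA Re_mulc.
- by apply: eq_integrable (integrableD measurableT
    (integrableZl measurableT (Re a) j1) (integrableZl measurableT (Im a) i1)).
- by apply: filterS (cL2Z a u) => x ->; rewrite -mulrA Im_mulc.
all: by [exact: (integrableZl measurableT _ i1)
        | exact: (integrableZl measurableT _ j1)].
Qed.

(** As for any complex integral: rotate u by conjc z, where z is the inner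
    product, so that the integral becomes real. *)
Lemma normc_dot_le u v :
  normc (cL2dot u v) <= \int[mu]_x (normc (u x) * normc (v x)).
Proof.
set z := cL2dot u v.
have [->|z0] := eqVneq (normc z) 0.
  by apply: Rintegral_ge0 => x _; rewrite mulr_ge0 ?normc_ge0.
have zpos : 0 < normc z by rewrite lt0r z0 normc_ge0.
rewrite -(ler_pM2l zpos) -expr2.
have -> : normc z ^+ 2 = Re (cL2dot (conjc z *: u) v).
  by rewrite cL2dotZl Re_mulc Re_conjc Im_conjc mulNr opprK normc_sqr !expr2.
rewrite -RintegralZl//; last exact: integrable_normc_mul.
apply: ae_le_Rintegral.
- by have [] := dot_integrable (conjc z *: u) v.
- exact: integrableZl (integrable_normc_mul u v).
apply: filterS (cL2Z (conjc z) u) => x ->.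
apply: le_trans (ler_norm _) _; apply: le_trans (normr_Re_le _) _.
by rewrite !normcM !normc_conjc mulrA.
Qed.

(** A crude substitute for the Cauchy-Schwarz inequality, which suffices to
    bound numerical values on the unit sphere. *)
Lemma normc_dot_le_sqr u v :
  normc (cL2dot u v) <= cL2norm u ^+ 2 + cL2norm v ^+ 2.
Proof.
apply: le_trans (normc_dot_le u v) _; rewrite !cL2norm_sqr -RintegralD//;
  try exact: integrable_normc_sqr.
apply: le_Rintegral => //; first exact: integrable_normc_mul.
  exact: (integrableD measurableT
    (integrable_normc_sqr u) (integrable_normc_sqr v)).
move=> x _; have := sqr_ge0 (normc (u x) - normc (v x)).
have := sqr_ge0 (normc (u x) + normc (v x)).
rewrite sqrrB sqrrD; lra.
Qed.

Lemma Re_dot_ge0 u v : cL2_nonneg u -> cL2_nonneg v -> 0 <= Re (cL2dot u v).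
Proof.
move=> u0 v0; have -> : 0 = \int[mu]_(x in setT) (0 : R).
  by rewrite Rintegral_cst// mul0r.
apply: ae_le_Rintegral => //.
- exact: integrable0.
- by have [] := dot_integrable u v.
apply: filterS2 u0 v0 => x ux vx.
rewrite (normc_ge0E ux) (normc_ge0E vx) Re_mulc Re_conjc Im_conjc/=.
by rewrite mul0r subr0 mulr_ge0 ?normc_ge0.
Qed.

End L2_facts.

(** * Positive operators *)

Section positive_operators.
Context d (T : measurableType d) (R : realType).
Variable mu : {measure set T -> \bar R}.
Implicit Types u v w : cL2 mu.

Lemma cL2B u v : {ae mu, forall x, (u - v : cL2 mu) x = u x - v x}.
Proof.
have := cL2Z (-1) v; rewrite scaleN1r.
by apply: filterS2 (cL2D u (- v)) => x -> ->; rewrite mulN1r.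
Qed.

Lemma cL2_abs u : exists v, {ae mu, forall x, v x = (normc (u x))%:C%C}.
Proof.
apply: (@cL2_of_dominated _ _ _ _ u) => [|x]; last first.
  by rewrite normcR ger0_norm ?normc_ge0.
by split; [exact: cL2_measurable_normc | exact: measurable_cst].
Qed.

Lemma cL2_Re u : exists v, {ae mu, forall x, v x = (Re (u x))%:C%C}.
Proof.
apply: (@cL2_of_dominated _ _ _ _ u) => [|x]; last by rewrite normcR normr_Re_le.
by have [mr _] := cL2_cmeasurable u; split => //; exact: measurable_cst.
Qed.

Lemma cL2_Im u : exists v, {ae mu, forall x, v x = (Im (u x))%:C%C}.
Proof.
apply: (@cL2_of_dominated _ _ _ _ u) => [|x]; last by rewrite normcR normr_Im_le.
by have [_ mi] := cL2_cmeasurable u; split => //; exact: measurable_cst.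
Qed.

(** A real u is the difference of the nonnegative functions |u| and |u| - u. *)
Lemma positive_op_real (A : {linear cL2 mu -> cL2 mu}) u : positive_op A ->
  {ae mu, forall x, Im (u x) = 0} -> {ae mu, forall x, Im ((A u : cL2 mu) x) = 0}.
Proof.
move=> A0 ur; have [v vE] := cL2_abs u.
have v0 : cL2_nonneg v.
  by apply: filterS vE => x ->; rewrite complex_ge0 eqxx normc_ge0.
have w0 : cL2_nonneg (v - u).
  apply: filterS3 (cL2B v u) vE ur => x -> -> ux.
  have := normr_Re_le (u x); rewrite ler_norml => /andP[_].
  by case: (u x) ux => a b /= ->; rewrite complex_ge0/= subr0 eqxx subr_ge0.
have -> : A u = A v - A (v - u) by rewrite -linearB/= opprB addrC subrK.
apply: filterS3 (cL2B (A v) (A (v - u))) (A0 _ v0) (A0 _ w0) => x ->.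
rewrite !complex_ge0 => /andP[/eqP + _] /andP[/eqP + _].
case: ((A v : cL2 mu) x) => ? ?; case: ((A _ : cL2 mu) x) => ? ? /= -> ->.
by rewrite subr0.
Qed.

(** Since A preserves real functions, Re (A u) is A applied to the real part p
    of u, and |u| - p >= 0. *)
Lemma positive_op_Re_le (A : {linear cL2 mu -> cL2 mu}) u v : positive_op A ->
  {ae mu, forall x, v x = (normc (u x))%:C%C} ->
  {ae mu, forall x, Re ((A u : cL2 mu) x) <= Re ((A v : cL2 mu) x)}.
Proof.
move=> A0 vE; have [[p pE] [s sE]] := (cL2_Re u, cL2_Im u).
have uE : u = p + Complex 0 1 *: s.
  apply/cL2_eqP; apply: filterS3 (cL2D p (Complex 0 1 *: s)) (cL2Z (Complex 0 1) s)
    (filterI pE sE) => x -> -> [-> ->].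
  case: (u x) => a b; apply/eqP.
  by rewrite eq_complex/= !mul0r mul1r subr0 !addr0 !add0r ?mul1r !eqxx.
have vp0 : cL2_nonneg (v - p).
  apply: filterS3 (cL2B v p) vE pE => x -> -> ->.
  rewrite complex_ge0/= subr0 eqxx subr_ge0.
  by have := normr_Re_le (u x); rewrite ler_norml => /andP[_].
have sr : {ae mu, forall x, Im ((A s : cL2 mu) x) = 0}.
  by apply: positive_op_real => //; apply: filterS sE => x ->.
have AE : {ae mu, forall x,
    (A u : cL2 mu) x = (A p : cL2 mu) x + Complex 0 1 * (A s : cL2 mu) x}.
  rewrite uE linearD linearZ/=.
  apply: filterS2 (cL2D (A p) (Complex 0 1 *: A s)) (cL2Z (Complex 0 1) (A s)).
  by move=> x -> ->.
have := A0 _ vp0; rewrite linearB/=.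
apply: filterS3 (filterI AE sr) (cL2B (A v) (A p)) => x [-> sx] ->.
rewrite complex_ge0 => /andP[_].
case: ((A s : cL2 mu) x) sx => a b /= ->.
case: ((A p : cL2 mu) x) ((A v : cL2 mu) x) => ? ? [? ?]/=.
by rewrite mul0r mulr0 subr0 addr0 subr_ge0.
Qed.

(** The inequality of real parts holds for q u and |q| v outside a null set that
    depends on q; the union of these null sets over all q with rational parts
    is still null. *)
Lemma positive_op_normc_le (A : {linear cL2 mu -> cL2 mu}) u v : positive_op A ->
  {ae mu, forall x, v x = (normc (u x))%:C%C} ->
  {ae mu, forall x, normc ((A u : cL2 mu) x) <= Re ((A v : cL2 mu) x)}.
Proof.
move=> A0 vE.
have v0 : cL2_nonneg v.
  by apply: filterS vE => x ->; rewrite complex_ge0 eqxx normc_ge0.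
have qP (q : R[i]) : {ae mu, forall x,
    Re (q * (A u : cL2 mu) x) <= normc q * Re ((A v : cL2 mu) x)}.
  have qvE : {ae mu, forall x, ((normc q)%:C%C *: v : cL2 mu) x
      = (normc ((q *: u : cL2 mu) x))%:C%C}.
    apply: filterS3 (cL2Z (normc q)%:C%C v) (cL2Z q u) vE => x -> -> ->.
    by rewrite normcM rmorphM.
  have := positive_op_Re_le A0 qvE; rewrite !linearZ/=.
  apply: filterS3 (cL2Z q (A u)) (cL2Z (normc q)%:C%C (A v)) => x -> ->.
  by rewrite (Re_mulc _%:C%C) /= mul0r subr0.
(* Pairs of rationals are indexed by nat to use the countable additivity. *)
have : {ae mu, forall x, forall n, forall p : rat * rat, unpickle n = Some p ->
    let q := Complex (ratr p.1) (ratr p.2) in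
    Re (q * (A u : cL2 mu) x) <= normc q * Re ((A v : cL2 mu) x)}.
  apply: ae_foralln => n; case: (unpickle n) => [p|]; last exact: nearW.
  by apply: filterS (qP (Complex (ratr p.1) (ratr p.2))) => x h p' [<-].
apply: filterS2 (A0 _ v0) => x; rewrite complex_ge0 => /andP[_ Av0] H.
apply: normc_le_rat => // p; exact: (H (pickle p) p (pickleK p)).
Qed.

Lemma numerical_value_le (A : {linear cL2 mu -> cL2 mu}) u : positive_op A ->
  exists v, [/\ cL2_nonneg v, cL2norm v = cL2norm u &
    normc (cL2dot (A u) u) <= Re (cL2dot (A v) v)].
Proof.
move=> A0; have [v vE] := cL2_abs u; exists v.
have nvE : {ae mu, forall x, normc (v x) = normc (u x)}.
  by apply: filterS vE => x ->; rewrite normcR ger0_norm ?normc_ge0.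
split.
- by apply: filterS vE => x ->; rewrite complex_ge0 eqxx normc_ge0.
- by apply/eqP; rewrite eq_le; apply/andP; split; apply: cL2norm_ler;
    apply: filterS nvE => x ->.
apply: le_trans (normc_dot_le _ _) _; apply: ae_le_Rintegral.
- exact: integrable_normc_mul.
- by have [] := dot_integrable (A v) v.
apply: filterS2 vE (positive_op_normc_le A0 vE) => x -> Ax.
rewrite Re_mulc/= oppr0 mulr0 subr0 -/(normc _).
by rewrite ler_wpM2r// normc_ge0.
Qed.

End positive_operators.

(** * Numerical radius *)

Section numerical_radius_facts.
Context d (T : measurableType d) (R : realType).
Variable mu : {measure set T -> \bar R}.
Implicit Types u v w : cL2 mu.

Lemma bounded_op_comp (B C : cL2 mu -> cL2 mu) :
  bounded_op B -> bounded_op C -> bounded_op (B \o C).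
Proof.
move=> [M BM] [N CN]; exists (`|M| * N) => u /=.
apply: le_trans (BM _) _; rewrite -mulrA.
apply: le_trans (ler_wpM2r (cL2norm_ge0 _) (ler_norm M)) _.
by rewrite ler_wpM2l// CN.
Qed.

Lemma multiplication_op_bounded (D : cL2 mu -> cL2 mu) :
  multiplication_op D -> bounded_op D.
Proof.
move=> [m /cLfunP[mm mfin] DE].
have [M mM] : exists M : R, {ae mu, forall x, normc (m x) <= M}.
  move: mfin; rewrite /finite_norm unlock; case: ifPn => [_|mu0 _].
    move=> /(@ess_supr_bounded _ _ _ mu (fun x => `|normc (m x)|))[M H].
    by exists M; apply: filterS H => x; apply: le_trans; exact: ler_norm.
  (* The norm is 0 by convention if mu is zero, and then every bound holds. *)
  exists 0, setT; split => //; apply/eqP.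
  by rewrite eq_le measure_ge0 andbT leNgt.
exists `|M| => u.
rewrite -ler_sqr ?nnegrE ?mulr_ge0 ?cL2norm_ge0// exprMn.
rewrite !cL2norm_sqr -RintegralZl//; last exact: integrable_normc_sqr.
apply: ae_le_Rintegral; first exact: integrable_normc_sqr.
  exact: integrableZl (integrable_normc_sqr u).
apply: filterS2 mM (DE u) => x mx ->; rewrite normcM exprMn ler_wpM2r ?sqr_ge0//.
rewrite ler_sqr ?nnegrE ?normc_ge0//; exact: le_trans mx (ler_norm _).
Qed.

Lemma normc_dot_le_numerical_radius (B : cL2 mu -> cL2 mu) u :
  bounded_op B -> cL2norm u = 1 -> normc (cL2dot (B u) u) <= numerical_radius B.
Proof.
move=> [M BM] u1; apply: ub_le_sup; last by exists u.
exists (M ^+ 2 + 1) => _ [v /= v1 <-].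
apply: le_trans (normc_dot_le_sqr _ _) _; rewrite v1 expr1n lerD2r.
have := BM v; rewrite v1 mulr1 => BvM.
by rewrite ler_sqr ?nnegrE ?cL2norm_ge0// (le_trans (cL2norm_ge0 _) BvM).
Qed.

(** The hypothesis on B and C is the operator form of the inequality
    2 A <= t B + t^-1 C. It is stated on nonnegative functions, where the
    numerical radius of A can be computed. *)
Lemma numerical_radius_AMGM (A : {linear cL2 mu -> cL2 mu})
    (B C : cL2 mu -> cL2 mu) :
  positive_op A -> bounded_op B -> bounded_op C ->
  (forall t u, 0 < t -> cL2_nonneg u ->
    cL2_nonneg (t%:C%C *: B u + (t^-1)%:C%C *: C u - 2%:C%C *: A u)) ->
  numerical_radius A ^+ 2 <= numerical_radius B * numerical_radius C.
Proof.
move=> A0 Bb Cb H.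
have [[u0 u01]|nu] := pselect (exists u : cL2 mu, cL2norm u = 1); last first.
  rewrite /numerical_radius (_ : [set u | _] = set0).
    by rewrite !image_set0 sup0 mul0r expr0n.
  by apply/seteqP; split=> // u u1; apply: nu; exists u.
have B0 : 0 <= numerical_radius B.
  exact: le_trans (normc_ge0 _) (normc_dot_le_numerical_radius Bb u01).
have C0 : 0 <= numerical_radius C.
  exact: le_trans (normc_ge0 _) (normc_dot_le_numerical_radius Cb u01).
have ubA u : cL2norm u = 1 ->
    normc (cL2dot (A u) u) <= Num.sqrt (numerical_radius B * numerical_radius C).
  move=> u1; have [v [v0 vn uv]] := numerical_value_le u A0.
  rewrite u1 in vn; apply: le_trans uv _.
  have Av0 : 0 <= Re (cL2dot (A v) v) by apply: Re_dot_ge0 => //; exact: A0.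
  rewrite -(ger0_norm Av0) -sqrtr_sqr ler_wsqrtr//.
  apply: sqr_le_of_AMGM => // t t0.
  have := Re_dot_ge0 (H t v t0 v0) v0.
  rewrite -scaleNr !cL2dotDl !cL2dotZl -rmorphN !Re_addc !Re_mulc/=.
  rewrite !mul0r !subr0 mulNr subr_ge0 => h; apply: le_trans h _.
  have tB : Re (cL2dot (B v) v) <= numerical_radius B.
    apply: le_trans (ler_norm _) _; apply: le_trans (normr_Re_le _) _.
    exact: normc_dot_le_numerical_radius.
  have tC : Re (cL2dot (C v) v) <= numerical_radius C.
    apply: le_trans (ler_norm _) _; apply: le_trans (normr_Re_le _) _.
    exact: normc_dot_le_numerical_radius.
  by apply: lerD; rewrite ler_wpM2l// ?invr_ge0 ltW.
have S0 : 0 <= numerical_radius A.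
  apply: le_trans (normc_ge0 (cL2dot (A u0) u0)) _.
  apply: ub_le_sup; last by exists u0.
  exists (Num.sqrt (numerical_radius B * numerical_radius C)).
  by move=> _ [v /= v1 <-]; exact: ubA.
rewrite -[leRHS]sqr_sqrtr ?mulr_ge0// ler_sqr ?nnegrE//.
apply: ge_sup; first by exists (normc (cL2dot (A u0) u0)), u0.
by move=> _ [v /= v1 <-]; exact: ubA.
Qed.

(** With m the multiplier of D and k = D^-1 u, so that u = m k, the combination
    is (t m - 1)^2 u / (t m) where k does not vanish, and 0 elsewhere. *)
Lemma multiplication_op_AMGM (D Dinv : {linear cL2 mu -> cL2 mu}) (t : R) u :
  multiplication_op D -> positive_op D -> cancel Dinv D ->
  0 < t -> cL2_nonneg u ->
  cL2_nonneg (t%:C%C *: D u + (t^-1)%:C%C *: Dinv u - 2%:C%C *: u).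
Proof.
move=> [m _ DE] D0 DinvK t0 u0.
(* D |w| = m |w| >= 0 gives m >= 0 where w does not vanish; there m is also
   nonzero, because w = D (D^-1 w) = m (D^-1 w). *)
have m_gt0 w : {ae mu, forall x, w x != 0 -> 0 < m x}.
  have [v vE] := cL2_abs w.
  have v0 : cL2_nonneg v.
    by apply: filterS vE => x ->; rewrite complex_ge0 eqxx normc_ge0.
  have mv := DE (Dinv w); rewrite DinvK in mv.
  apply: filterS3 (filterI mv vE) (DE v) (D0 _ v0) => x [wx ->] -> mx wx0.
  rewrite lt_def; apply/andP; split.
    by apply: contra_neq wx0 => mx0; rewrite wx mx0 mul0r.
  move: mx; rewrite pmulr_lge0// ltcR lt0r normc_ge0 andbT.
  by apply: contra_neq wx0 => /eq0_normc.
have mDinv := DE (Dinv u); rewrite DinvK in mDinv.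
have combE : {ae mu, forall x,
    (t%:C%C *: D u + (t^-1)%:C%C *: Dinv u - 2%:C%C *: u : cL2 mu) x
    = t%:C%C * (D u : cL2 mu) x + (t^-1)%:C%C * (Dinv u : cL2 mu) x
      - 2%:C%C * u x}.
  apply: filterS3 (filterI
      (cL2B (t%:C%C *: D u + (t^-1)%:C%C *: Dinv u) (2%:C%C *: u))
      (cL2D (t%:C%C *: D u) ((t^-1)%:C%C *: Dinv u)))
    (filterI (cL2Z t%:C%C (D u)) (cL2Z (t^-1)%:C%C (Dinv u))) (cL2Z 2%:C%C u).
  by move=> x [-> ->] [-> ->] ->.
apply: filterS3 (filterI mDinv (DE u)) (m_gt0 (Dinv u))
  (filterI combE u0).
move=> x [ux Dux] mk0 [-> ux0]; rewrite Dux {Dux}.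
move: (u x) ((Dinv u : cL2 mu) x) (m x) ux mk0 ux0 => a k m' ak mk a0.
have [k0|k0] := eqVneq k 0.
  by rewrite ak k0 !mulr0 addr0 subr0.
have m'0 : 0 < m' := mk k0.
have s0 : 0 < t%:C%C :> R[i] by rewrite ltcR.
rewrite rmorphV ?unitfE ?gt_eqF//=.
have -> : t%:C%C * (m' * a) + (t%:C%C)^-1 * k - 2%:C%C * a
    = (t%:C%C * m' - 1) ^+ 2 * (a / (t%:C%C * m')).
  have -> : (2 : R)%:C%C = 2 :> R[i] by rewrite rmorph_nat.
  rewrite ak; field.
  by rewrite !gt_eqF.
apply: mulr_ge0; last by rewrite divr_ge0// mulr_ge0 ?ltW.
by rewrite -realEsqr rpredB ?rpred1// rpredM// gtr0_real.
Qed.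

End numerical_radius_facts.

(** * The inequalities for the numerical radius *)

Theorem corollary2p4 (d : measure_display) (T : measurableType d) (R : realType)
    (mu : {sigma_finite_measure set T -> \bar R})
    (D Dinv A : {linear cL2 mu -> cL2 mu}) :
  multiplication_op D -> positive_op D -> inverse_op D Dinv ->
  bounded_op A -> positive_op A ->
  numerical_radius A ^+ 2
    <= numerical_radius (D \o A) * numerical_radius (Dinv \o A) /\
  numerical_radius A ^+ 2
    <= numerical_radius (A \o D) * numerical_radius (A \o Dinv).
Proof.
move=> Dm D0 [Dinvb _ DinvK] Ab A0.
have Db := multiplication_op_bounded Dm.
split; apply: numerical_radius_AMGM => //; try exact: bounded_op_comp.
- by move=> t u t0 u0; have := multiplication_op_AMGM Dm D0 DinvK t0 (A0 _ u0).
- move=> t u t0 u0; have := A0 _ (multiplication_op_AMGM Dm D0 DinvK t0 u0).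
  by rewrite linearB linearD !linearZ.
Qed.
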